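(* For $S\subseteq\omega$ let $\mathcal{R}(S)=\{2^n m : n\in S,\ m \text{ odd}\}$ and $\widetilde{\mathcal{R}}(S)=\{2^n+m : n\in S,\ m<2^n\}$. (1) The map $S\mapsto\widetilde{\mathcal{R}}(S)$ induces an embedding of the cofinite degrees into the generic degrees; i.e., for all $A,B\subseteq\omega$, $B\leq_{\mathrm{cf}}A$ if and only if $\widetilde{\mathcal{R}}(B)\leq_{\mathrm{g}}\widetilde{\mathcal{R}}(A)$. (2) The map $S\mapsto\widetilde{\mathcal{R}}(S)$ induces an embedding of the mod-finite degrees into the coarse degrees; i.e., for all $A,B\subseteq\omega$, $B\leq_{\mathrm{mf}}A$ if and only if $\widetilde{\mathcal{R}}(B)\leq_{\mathrm{cor}}\widetilde{\mathcal{R}}(A)$. (3) The map $S\mapsto\mathcal{R}(S)$ induces an embedding of the Turing degrees into the cofinite degrees; i.e., for all $A,B\subseteq\omega$, $B\leq_{T}A$ if and only if $\mathcal{R}(B)\leq_{\mathrm{cf}}\mathcal{R}(A)$. (4) The map $S\mapsto\mathcal{R}(S)$ induces an embedding of the Turing degrees into the mod-finite degrees; i.e., for all $A,B\subseteq\omega$, $B\leq_{T}A$ if and only if $\mathcal{R}(B)\leq_{\mathrm{mf}}\mathcal{R}(A)$.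
   Context: Sets are subsets of $\omega$ and are identified with their characteristic functions. $\leq_T$ is Turing reducibility. For partial functions $f,g$ on $\omega$, $f\simeq g$ means $f(n)=g(n)$ for every $n$ in both domains. A set $D\subseteq\omega$ has density $1$ if $\lim_{n}|D\cap n|/n=1$ (where $n=\{0,\dots,n-1\}$). Partial oracles. A partial oracle $(A)$ for a set $A$ is a set of triples $\langle n,x,l\rangle$ such that if $\langle n,0,l\rangle\in(A)$ for some $l$ then $n\notin A$, and if $\langle n,1,l\rangle\in(A)$ for some $l$ then $n\in A$. It is regarded as a partial function $(A):\omega\to\{0,1\}$ mapping $n$ to $x$ and taking $l$ steps to converge; its domain is the set of $n$ for which such $x,l$ exist. To query the $n$th bit of $(A)$ is to start a search for $x,l$ with $\langle n,x,l\rangle\in(A)$; while waiting, a computation may do other calculations and query other bits. A set $A$ is regarded as a partial oracle for itself that immediately halts on every input. Reducibilities. In each case $\Phi$ ranges over Turing functionals; the corresponding degrees are the equivalence classes under mutual reducibility, ordered by the reducibility. - $B\leq_{\mathrm{mf}}A$ (mod-finite): there is $\Phi$ with $\Phi^A=B$ such that for any set $C$, if $\{n:C(n)=A(n)\}$ is cofinite then $\Phi^C$ is total and $\{n:\Phi^C(n)=B(n)\}$ is cofinite. - $B\leq_{\mathrm{cf}}A$ (cofinite): there is $\Phi$ with $\Phi^A=B$ such that for any partial oracle $(A)$ for $A$ with cofinite domain, $\Phi^{(A)}\simeq B$ and $\Phi^{(A)}$ has cofinite domain. - $B\leq_{\mathrm{g}}A$ (generic): there is $\Phi$ such that for any partial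 oracle $(A)$ for $A$ with density-$1$ domain, $\Phi^{(A)}$ has density-$1$ domain and $\Phi^{(A)}\simeq B$. - $B\leq_{\mathrm{cor}}A$ (coarse): there is $\Phi$ such that for any set $C$, if $\{n:C(n)=A(n)\}$ has density $1$ then $\Phi^C$ is total and $\{n:\Phi^C(n)=B(n)\}$ has density $1$. *)

(* Defs.v *)
From mathcomp Require Import all_boot all_order all_algebra.
From mathcomp Require Import all_classical topology normedtype.
From Stdlib Require Cantor.

Set Implicit Arguments.
Unset Strict Implicit.
Unset Printing Implicit Defensive.

Import Order.TTheory GRing.Theory Num.Theory.
Import numFieldNormedType.Exports.

Local Open Scope classical_set_scope.

(* A partial function is represented by its graph: [f n y] means that [f] is
   defined at [n] with value [y]. *)
Definition pfun := nat -> nat -> Prop.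

Definition pdom (f : pfun) : set nat := [set n | exists y, f n y].

Definition total (f : pfun) : Prop := pdom f = setT.

Definition chi (S : set nat) : pfun := fun n y => y = nat_of_bool (n \in S).

(* [f] and [g] agree wherever both are defined. *)
Definition compat (f g : pfun) : Prop :=
  forall n y z, f n y -> g n z -> y = z.

(* The set of [n] at which [f] and [g] are both defined and equal. *)
Definition agree (f g : pfun) : set nat := [set n | exists y, f n y /\ g n y].

Definition density1 (D : set nat) : Prop :=
  (fun n : nat => (#|[pred k : 'I_n | val k \in D]|%:R / n%:R)%R : rat^o)
    @ \oo --> (1%R : rat^o).

(* Turing functionals are presented by Kleene's schemes for the functions
   partial recursive in an oracle. Programs are unary; several arguments are
   passed through the Cantor bijection between nat * nat and nat. *)
Definition cpair (x y : nat) : nat := Cantor.to_nat (x, y).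
Definition cfst (z : nat) : nat := (Cantor.of_nat z).1.
Definition csnd (z : nat) : nat := (Cantor.of_nat z).2.

Inductive functional : Type :=
| Zero
| Succ
| Fst
| Snd
| Query
| Pair of functional & functional
| Comp of functional & functional
| Prec of functional & functional
| Mu of functional.

Fixpoint prec_graph (f g : pfun) (a n : nat) : nat -> Prop :=
  match n with
  | 0 => f a
  | n'.+1 => fun y =>
      exists z, prec_graph f g a n' z /\ g (cpair a (cpair n' z)) y
  end.

Definition mu_graph (f : pfun) (a y : nat) : Prop :=
  f (cpair a y) 0 /\ forall z, z < y -> exists w, f (cpair a z) w.+1.

(* [run X Phi] is the partial function Phi^X. *)
Fixpoint run (X : set nat) (Phi : functional) : pfun :=
  match Phi with
  | Zero => fun _ y => y = 0
  | Succ => fun x y => y = x.+1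
  | Fst => fun x y => y = cfst x
  | Snd => fun x y => y = csnd x
  | Query => chi X
  | Pair F G => fun x y =>
      exists u v, [/\ run X F x u, run X G x v & y = cpair u v]
  | Comp F G => fun x y => exists u, run X G x u /\ run X F u y
  | Prec F G => fun x => prec_graph (run X F) (run X G) (cfst x) (csnd x)
  | Mu F => mu_graph (run X F)
  end.

Lemma run_functional (X : set nat) (Phi : functional) (x y z : nat) :
  run X Phi x y -> run X Phi x z -> y = z.
Proof.
elim: Phi x y z => [|||||F IF G IG|F IF G IG|F IF G IG|F IF] x y z /=;
  try by move=> -> ->.
- by move=> [u [v [Fu Gv ->]]] [u' [v' [Fu' Gv' ->]]];
    rewrite (IF _ _ _ Fu Fu') (IG _ _ _ Gv Gv').
- move=> [u [Gu Fy]] [v [Gv Fz]].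
  by rewrite (IG _ _ _ Gv Gu) in Fz; apply: IF Fy Fz.
- elim: (csnd x) y z => [|n IHn] y z /=; first exact: IF.
  move=> [u [Pu Gy]] [v [Pv Gz]].
  by rewrite (IHn _ _ Pv Pu) in Gz; apply: IG Gy Gz.
- move=> [Fy Hy] [Fz Hz]; case: (ltngtP y z) => // lt.
  + by have [w Fw] := Hz _ lt; have := IF _ _ _ Fy Fw.
  + by have [w Fw] := Hy _ lt; have := IF _ _ _ Fz Fw.
Qed.

(* The value component of a triple is restricted to {0, 1}. *)
Definition triples := set (nat * bool * nat).

Definition partial_oracle (A : set nat) (P : triples) : Prop :=
  forall n l, (P (n, false, l) -> ~ A n) /\ (P (n, true, l) -> A n).

Definition podom (P : triples) : set nat :=
  [set n | exists x l, P (n, x, l)].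

(* A set as a partial oracle for itself, halting immediately everywhere. *)
Definition self_oracle (A : set nat) : triples :=
  [set t | exists n, t = (n, n \in A, 0)].

Definition code_triple (t : nat * bool * nat) : nat :=
  let: (n, x, l) := t in cpair n (cpair (nat_of_bool x) l).

(* The functional has access to the set of triples itself, so querying bit [n]
   is a search for [x] and [l], which can be dovetailed with other searches. *)
Definition run_partial (P : triples) (Phi : functional) : pfun :=
  run (code_triple @` P) Phi.

Definition le_T (B A : set nat) : Prop :=
  exists Phi, run A Phi = chi B.

Definition le_mf (B A : set nat) : Prop :=
  exists Phi, run A Phi = chi B /\
    forall C : set nat, cofinite_set (agree (chi C) (chi A)) ->
      total (run C Phi) /\ cofinite_set (agree (run C Phi) (chi B)).

Definition le_cf (B A : set nat) : Prop :=
  exists Phi, run_partial (self_oracle A) Phi = chi B /\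
    forall P : triples, partial_oracle A P -> cofinite_set (podom P) ->
      compat (run_partial P Phi) (chi B) /\
      cofinite_set (pdom (run_partial P Phi)).

Definition le_g (B A : set nat) : Prop :=
  exists Phi,
    forall P : triples, partial_oracle A P -> density1 (podom P) ->
      density1 (pdom (run_partial P Phi)) /\
      compat (run_partial P Phi) (chi B).

Definition le_cor (B A : set nat) : Prop :=
  exists Phi,
    forall C : set nat, density1 (agree (chi C) (chi A)) ->
      total (run C Phi) /\ density1 (agree (run C Phi) (chi B)).

Definition calR (S : set nat) : set nat :=
  [set k | exists n m, [/\ S n, odd m & k = 2 ^ n * m]].

Definition calRt (S : set nat) : set nat :=
  [set k | exists n m, [/\ S n, m < 2 ^ n & k = 2 ^ n + m]].

(* Main.v *)
(* A set of density 1 misses less than half of almost every block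
   [2 ^ n, 2 ^ n.+1), whereas each class {2 ^ n * m | m odd} is infinite. A
   bit of [A] is thus recovered from a description of [calRt A] that is correct
   on a set of density 1 by a search or a majority vote over a block, for
   almost every bit; and from a description of [calR A] that is correct
   cofinitely often by an unbounded search in a class, for every bit. Conversely
   finitely many errors in [A] become finitely many errors in [calRt A], and
   finitely many errors in the resulting description of [B] are repaired by a
   finite table where exactness is required.

   Searches over computations that may diverge are dovetailed by means of an
   evaluator with bounded search, recursive in the oracle. *)

Require Import Defs.
From mathcomp Require Import all_boot all_order all_algebra.
From mathcomp Require Import all_classical topology normedtype.
From mathcomp Require Import zify.
From Stdlib Require Cantor.

Set Implicit Arguments.
Unset Strict Implicit.
Unset Printing Implicit Defensive.

Import Order.TTheory GRing.Theory Num.Theory.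
Import numFieldNormedType.Exports.

Local Open Scope classical_set_scope.

(** * Cantor pairing *)

Lemma cpairK1 x y : cfst (cpair x y) = x.
Proof. by rewrite /cfst /cpair Cantor.cancel_of_to. Qed.

Lemma cpairK2 x y : csnd (cpair x y) = y.
Proof. by rewrite /csnd /cpair Cantor.cancel_of_to. Qed.

Lemma cpair_surj z : cpair (cfst z) (csnd z) = z.
Proof.
by rewrite /cpair /cfst /csnd -surjective_pairing Cantor.cancel_to_of.
Qed.

Definition cpairE := (cpairK1, cpairK2).

(** * Functions recursive uniformly in the oracle *)

(** The index is chosen before the oracle, as in all four reducibilities. Totality makes these
    functions usable as tests inside searches. *)
Definition recursive (f : set nat -> nat -> nat) : Prop :=
  exists Phi, forall X x y, run X Phi x y <-> y = f X x.

Lemma eq_recursive f g :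
  (forall X z, f X z = g X z) -> recursive f -> recursive g.
Proof. by move=> fg [F HF]; exists F => X x y; rewrite -fg. Qed.

Lemma rec_id : recursive (fun X z => z).
Proof.
exists (Pair Fst Snd) => X x y /=; split.
  by move=> [u [v [-> -> ->]]]; rewrite cpair_surj.
by move=> ->; exists (cfst x), (csnd x); rewrite cpair_surj.
Qed.

Lemma rec_comp f g :
  recursive f -> recursive g -> recursive (fun X z => f X (g X z)).
Proof.
move=> [F HF] [G HG]; exists (Comp F G) => X x y /=; split.
  by move=> [u [/HG -> /HF]].
by move=> ->; exists (g X x); split; [apply/HG | apply/HF].
Qed.

Lemma rec_succ f : recursive f -> recursive (fun X z => (f X z).+1).
Proof. by apply: (@rec_comp (fun X => S)); exists Succ. Qed.

Lemma rec_fst f : recursive f -> recursive (fun X z => cfst (f X z)).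
Proof. by apply: (@rec_comp (fun X => cfst)); exists Fst. Qed.

Lemma rec_snd f : recursive f -> recursive (fun X z => csnd (f X z)).
Proof. by apply: (@rec_comp (fun X => csnd)); exists Snd. Qed.

Lemma rec_query f :
  recursive f -> recursive (fun X z => nat_of_bool (f X z \in X)).
Proof. by apply: (@rec_comp (fun X z => nat_of_bool (z \in X))); exists Query. Qed.

Lemma rec_const c : recursive (fun X z => c).
Proof. by elim: c => [|c /rec_succ//]; exists Zero. Qed.

Lemma rec_pair f g :
  recursive f -> recursive g -> recursive (fun X z => cpair (f X z) (g X z)).
Proof.
move=> [F HF] [G HG]; exists (Pair F G) => X x y /=; split.
  by move=> [u [v [/HF -> /HG -> ->]]].
by move=> ->; exists (f X x), (g X x); split => //; [apply/HF | apply/HG].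
Qed.

Lemma rec_on_fst f : recursive f -> recursive (fun X w => f X (cfst w)).
Proof. by move=> rf; apply: rec_comp rf (rec_fst rec_id). Qed.

(** [Prec] hands its step the nested pair of parameter, counter and previous value, which explains
    the decoding in the second hypothesis. Arithmetic and bounded quantifiers are all derived from
    this scheme. *)
Lemma rec_nat_rect f (g : set nat -> nat -> nat -> nat -> nat) n :
  recursive f ->
  recursive (fun X w => g X (cfst w) (cfst (csnd w)) (csnd (csnd w))) ->
  recursive n ->
  recursive (fun X z =>
    nat_rect (fun=> nat) (f X z) (fun i r => g X z i r) (n X z)).
Proof.
move=> [F HF] [G HG] recn.
(* The whole input serves as the parameter of the recursion. *)
have [P HP] := rec_pair rec_id recn.
exists (Comp (Prec F G) P) => X x y.
have prec_rect a k t : prec_graph (run X F) (run X G) a k t <->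
    t = nat_rect (fun=> nat) (f X a) (fun i r => g X a i r) k.
  elim: k t => [|k IH] t /=; first exact: HF.
  split; first by move=> [u [/IH -> /HG]]; rewrite !cpairE.
  by move=> ->; eexists; split; [apply/IH | apply/HG; rewrite !cpairE].
split => /=.
  by move=> [u [/HP -> /prec_rect]]; rewrite !cpairE.
move=> ->; exists (cpair x (n X x)); split; first exact/HP.
by apply/prec_rect; rewrite !cpairE.
Qed.

Lemma rec_add f g :
  recursive f -> recursive g -> recursive (fun X z => f X z + g X z).
Proof.
move=> rf rg; apply: eq_recursive
  (rec_nat_rect (g := fun _ _ _ => S) rf (rec_succ (rec_snd (rec_snd rec_id))) rg).
by move=> X z; elim: (g X z) => [|n /= ->]; rewrite ?addn0 ?addnS.
Qed.

Lemma rec_pred f : recursive f -> recursive (fun X z => (f X z).-1).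
Proof.
move=> rf; apply: eq_recursive (rec_nat_rect (g := fun _ _ i _ => i)
  (rec_const 0) (rec_fst (rec_snd rec_id)) rf).
by move=> X z; case: (f X z).
Qed.

Lemma rec_sub f g :
  recursive f -> recursive g -> recursive (fun X z => f X z - g X z).
Proof.
move=> rf rg; apply: eq_recursive (rec_nat_rect (g := fun _ _ _ => predn)
  rf (rec_pred (rec_snd (rec_snd rec_id))) rg).
by move=> X z; elim: (g X z) => [|n /= ->]; rewrite ?subn0 ?subnS.
Qed.

Lemma rec_mul f g :
  recursive f -> recursive g -> recursive (fun X z => f X z * g X z).
Proof.
move=> rf rg; apply: eq_recursive
  (rec_nat_rect (g := fun X z _ r => f X z + r) (rec_const 0)
    (rec_add (rec_on_fst rf) (rec_snd (rec_snd rec_id))) rg).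
by move=> X z; elim: (g X z) => [|n /= ->]; rewrite ?muln0 ?mulnS.
Qed.

Lemma rec_exp f g :
  recursive f -> recursive g -> recursive (fun X z => f X z ^ g X z).
Proof.
move=> rf rg; apply: eq_recursive
  (rec_nat_rect (g := fun X z _ r => f X z * r) (rec_const 1)
    (rec_mul (rec_on_fst rf) (rec_snd (rec_snd rec_id))) rg).
by move=> X z; elim: (g X z) => [|n /= ->]; rewrite ?expn0 ?expnS.
Qed.

(** Truncated subtraction: [1 - (f - g)] is 1 exactly when [f - g] vanishes. *)
Lemma rec_leq f g : recursive f -> recursive g ->
  recursive (fun X z => nat_of_bool (f X z <= g X z)).
Proof.
move=> rf rg; apply: eq_recursive
  (rec_sub (rec_const 1) (rec_sub rf rg)).
by move=> X z; rewrite /leq; case: (f X z - g X z) => [|[]].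
Qed.

Lemma rec_negb (p : set nat -> nat -> bool) :
  recursive (fun X z => p X z) -> recursive (fun X z => ~~ p X z).
Proof.
by move=> rp; apply: eq_recursive (rec_sub (rec_const 1) rp) => X z; case: (p X z).
Qed.

Lemma rec_andb (p q : set nat -> nat -> bool) :
  recursive (fun X z => p X z) -> recursive (fun X z => q X z) ->
  recursive (fun X z => p X z && q X z).
Proof.
by move=> rp rq; apply: eq_recursive (rec_mul rp rq) => X z;
  rewrite mulnb.
Qed.

Lemma rec_orb (p q : set nat -> nat -> bool) :
  recursive (fun X z => p X z) -> recursive (fun X z => q X z) ->
  recursive (fun X z => p X z || q X z).
Proof.
move=> rp rq; apply: eq_recursive
  (rec_negb (rec_andb (rec_negb rp) (rec_negb rq))) => X z.
by rewrite negb_and !negbK.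
Qed.

Lemma rec_eqn f g : recursive f -> recursive g ->
  recursive (fun X z => nat_of_bool (f X z == g X z)).
Proof.
move=> rf rg; apply: eq_recursive
  (rec_andb (rec_leq rf rg) (rec_leq rg rf)) => X z.
by rewrite eqn_leq.
Qed.

Lemma rec_if (p : set nat -> nat -> bool) f g :
  recursive (fun X z => p X z) -> recursive f -> recursive g ->
  recursive (fun X z => if p X z then f X z else g X z).
Proof.
move=> rp rf rg; apply: eq_recursive
  (rec_add (rec_mul rp rf) (rec_mul (rec_negb rp) rg)) => X z.
by case: (p X z); rewrite !(mul1n, mul0n, addn0).
Qed.

Lemma iota0S n : iota 0 n.+1 = iota 0 n ++ [:: n].
Proof. by rewrite -addn1 iotaD. Qed.

Lemma rec_count (p : set nat -> nat -> nat -> bool) n :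
  recursive (fun X w => p X (cfst w) (csnd w)) -> recursive n ->
  recursive (fun X z => count (fun i => p X z i) (iota 0 (n X z))).
Proof.
move=> rp rn; apply: eq_recursive
  (rec_nat_rect (g := fun X z i r => r + p X z i) (rec_const 0) _ rn).
  move=> X z; elim: (n X z) => // k IH.
  by rewrite iota0S count_cat -IH /= addn0.
apply: rec_add (rec_snd (rec_snd rec_id)) _.
apply: eq_recursive (rec_comp rp
  (rec_pair (rec_fst rec_id) (rec_fst (rec_snd rec_id)))) => X z.
by rewrite !cpairE.
Qed.

Lemma rec_has (p : set nat -> nat -> nat -> bool) n :
  recursive (fun X w => p X (cfst w) (csnd w)) -> recursive n ->
  recursive (fun X z => has (fun i => p X z i) (iota 0 (n X z))).
Proof.
move=> rp rn; apply: eq_recursive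
  (rec_leq (rec_const 1) (rec_count rp rn)) => X z.
by rewrite has_count.
Qed.

Lemma rec_all (p : set nat -> nat -> nat -> bool) n :
  recursive (fun X w => p X (cfst w) (csnd w)) -> recursive n ->
  recursive (fun X z => all (fun i => p X z i) (iota 0 (n X z))).
Proof.
move=> rp rn; apply: eq_recursive
  (rec_negb (rec_has (rec_negb rp) rn)) => X z.
by rewrite -all_predC; congr nat_of_bool; apply: eq_all => i; apply: negbK.
Qed.

(** The accumulator [r] equals the counter [i] as long as no witness has occurred below [i]; it
    grows at each such failure and is frozen at the first witness. *)
Lemma rec_find (p : set nat -> nat -> nat -> bool) n :
  recursive (fun X w => p X (cfst w) (csnd w)) -> recursive n ->
  recursive (fun X z => find (fun i => p X z i) (iota 0 (n X z))).
Proof.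
move=> rp rn; apply: eq_recursive
  (rec_nat_rect (g := fun X z i r => r + ((r == i) && ~~ p X z i))
     (rec_const 0) _ rn).
  move=> X z; elim: (n X z) => // k IH.
  rewrite iota0S find_cat has_find size_iota /= IH.
  have := find_size (fun i => p X z i) (iota 0 k); rewrite size_iota.
  by case: ltngtP => //= [_|->] _; rewrite ?addn0 //; case: (p X z k).
apply: rec_add (rec_snd (rec_snd rec_id)) _.
apply: rec_andb.
  exact: rec_eqn (rec_snd (rec_snd rec_id)) (rec_fst (rec_snd rec_id)).
apply: rec_negb.
apply: eq_recursive (rec_comp rp
  (rec_pair (rec_fst rec_id) (rec_fst (rec_snd rec_id)))) => X z.
by rewrite !cpairE.
Qed.

(** Dispatch is on the syntactic shape of the body. Any other goal is tried as a constant function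
    and is left open if that fails. *)
Ltac rec_step :=
  lazymatch goal with
  | |- recursive (fun X z => nat_of_bool (_ && _)) => apply: rec_andb
  | |- recursive (fun X z => nat_of_bool (_ || _)) => apply: rec_orb
  | |- recursive (fun X z => nat_of_bool (~~ _)) => apply: rec_negb
  | |- recursive (fun X z => nat_of_bool (_ <= _)) => apply: rec_leq
  | |- recursive (fun X z => nat_of_bool (_ == _)) => apply: rec_eqn
  | |- recursive (fun X z => nat_of_bool (has _ (iota 0 _))) => apply: rec_has
  | |- recursive (fun X z => nat_of_bool (all _ (iota 0 _))) => apply: rec_all
  | |- recursive (fun X z => find _ (iota 0 _)) => apply: rec_find
  | |- recursive (fun X z => count _ (iota 0 _)) => apply: rec_count
  | |- recursive (fun X z => cpair _ _) => apply: rec_pair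
  | |- recursive (fun X z => cfst _) => apply: rec_fst
  | |- recursive (fun X z => csnd _) => apply: rec_snd
  | |- recursive (fun X z => _ + _) => apply: rec_add
  | |- recursive (fun X z => _ - _) => apply: rec_sub
  | |- recursive (fun X z => _ * _) => apply: rec_mul
  | |- recursive (fun X z => _ ^ _) => apply: rec_exp
  | |- recursive (fun X z => _.-1) => apply: rec_pred
  | |- recursive (fun X z => if _ then _ else _) => apply: rec_if
  | |- recursive (fun X z => z) => exact: rec_id
  | |- recursive (fun X z => _.+1) => apply: rec_succ
  | |- recursive (fun X z => nat_of_bool (_ \in X)) => apply: rec_query
  | |- recursive _ => exact: rec_const
  end.

Ltac rec := repeat (assumption || rec_step).


(** * Divisibility and dyadic logarithms *)

Lemma rec_dvdn f g : recursive f -> recursive g ->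
  recursive (fun X z => nat_of_bool (f X z %| g X z)).
Proof.
move=> rf rg; apply: (@eq_recursive (fun X z =>
    has (fun q => q * f X z == g X z) (iota 0 (g X z).+1))).
  move=> X z; congr nat_of_bool; apply/hasP/dvdnP => [[q _ /eqP <-]|[q gE]].
    by exists q.
  (* For divisor 0 the given quotient may exceed the search bound; the dividend is then 0 and the
     quotient 0 works. *)
  have [f0|f0] := posnP (f X z).
    by exists 0 => //; rewrite gE f0 !muln0.
  exists q; last by rewrite gE.
  by rewrite mem_iota /= add0n ltnS gE leq_pmulr.
rec; [exact: rec_on_fst rf | exact: rec_on_fst rg].
Qed.

(** The logarithm of [k] is the least [i] with [k < 2 ^ i.+1], and it is below [k] when [k] is
    positive. For [k = 0] the empty range returns 0, the conventional value of [trunc_log]. *)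
Lemma rec_log2 f : recursive f -> recursive (fun X z => trunc_log 2 (f X z)).
Proof.
move=> rf; apply: (@eq_recursive (fun X z =>
  find (fun i => f X z < 2 ^ i.+1) (iota 0 (f X z)))).
  move=> X z; move: (f X z) => {rf}k; case: (posnP k) => [->|k0].
    by rewrite trunc_log0.
  have /andP[lo hi] := trunc_log_bounds (ltnSn 1) k0.
  set l := trunc_log 2 k in lo hi *; set p := fun i => _.
  have lk : l < k by apply: leq_trans lo; apply: ltn_expl.
  have hp : has p (iota 0 k) by apply/hasP; exists l; rewrite ?mem_iota.
  have fk : find p (iota 0 k) < k by rewrite -[X in _ < X](size_iota 0) -has_find.
  apply/eqP; rewrite eqn_leq; apply/andP; split.
    rewrite leqNgt; apply/negP => /(before_find 0).
    by rewrite nth_iota // add0n /p hi.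
  have := nth_find 0 hp; rewrite nth_iota // add0n /p => h.
  by rewrite -ltnS -(ltn_exp2l _ _ (ltnSn 1)) (leq_ltn_trans lo).
by rec; exact: rec_on_fst rf.
Qed.

(** The valuation counts the exponents from 1 to [k - 1] whose power of 2 divides [k]; the shift by
    one drops exponent 0. *)
Lemma rec_logn2 f : recursive f -> recursive (fun X z => logn 2 (f X z)).
Proof.
move=> rf; apply: (@eq_recursive (fun X z =>
  count (fun i => 2 ^ i.+1 %| f X z) (iota 0 (f X z).-1))).
  move=> X z; rewrite logn_count_dvd // -sum1_count big_mkcond /=.
  rewrite [RHS](big_addn 0 _ 1) subn1 /index_iota subn0 /=.
  by apply: eq_bigr => i _; rewrite addn1; case: ifP.
rec; apply: rec_dvdn; rec; exact: rec_on_fst rf.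
Qed.

(** * Unbounded search and composition of functionals *)

(** Since [p] is total, the search cannot get stuck before a witness. The witness found is the least
    one, but later soundness arguments hold for any witness, so only its existence is recorded. *)
Lemma recursive_search (p : set nat -> nat -> nat -> bool)
    (h : set nat -> nat -> nat -> nat) :
  recursive (fun X w => p X (cfst w) (csnd w)) ->
  recursive (fun X w => h X (cfst w) (csnd w)) ->
  exists Phi, forall X x,
    (forall y, run X Phi x y -> exists2 s, p X x s & y = h X x s) /\
    ((exists s, p X x s) -> exists y, run X Phi x y).
Proof.
move=> rp [H HH].
(* [Mu] looks for the value 0, hence the negation of [p]. *)
have [F HF] := rec_negb rp; have [I HI] := rec_id.
exists (Comp H (Pair I (Mu F))) => X x; split=> /=.
  move=> y [w [[u [s [/HI -> [/HF + _] ->]]]]].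
  rewrite !cpairE => ps /HH; rewrite !cpairE => ->; exists s => //.
  by move: ps; case: (p X x s).
move=> exs; have [s ps smin] := ex_minnP exs.
exists (h X x s), (cpair x s); split; last by apply/HH; rewrite !cpairE.
exists x, s; split; [exact/HI | split | by []].
  by apply/HF; rewrite !cpairE ps.
move=> t ts; exists 0; apply/HF; rewrite !cpairE.
by case: (boolP (p X x t)) => // /smin; rewrite leqNgt ts.
Qed.

(** The output map [h] also sees the input [x], so the result can be corrected at exceptional inputs
    such as 0. *)
Lemma run_map Phi g h : recursive g -> recursive h ->
  exists Psi, forall X x y,
    run X Psi x y <->
    exists2 u, run X Phi (g X x) u & y = h X (cpair x u).
Proof.
move=> [G HG] [H HH]; have [I HI] := rec_id.
exists (Comp H (Pair I (Comp Phi G))) => X x y /=; split.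
  by move=> [_ [[_ [v [/HI -> [_ [/HG -> Pv]] ->]]] /HH ->]]; exists v.
move=> [u Pu ->]; exists (cpair x u); split; last exact/HH.
exists x, u; split => //; first exact/HI.
by exists (g X x); split => //; apply/HG.
Qed.

Fixpoint subst_query (Psi Phi : functional) : functional :=
  match Phi with
  | Zero => Zero
  | Succ => Succ
  | Fst => Fst
  | Snd => Snd
  | Query => Psi
  | Pair F G => Pair (subst_query Psi F) (subst_query Psi G)
  | Comp F G => Comp (subst_query Psi F) (subst_query Psi G)
  | Prec F G => Prec (subst_query Psi F) (subst_query Psi G)
  | Mu F => Mu (subst_query Psi F)
  end.

(** Composition of reductions: each query to [Y] is replaced by a computation of that bit from
    [X]. *)
Lemma run_subst_query X Y Psi Phi :
  run X Psi = chi Y -> run X (subst_query Psi Phi) = run Y Phi.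
Proof.
by move=> PsiY; elim: Phi => //= [F -> G ->|F -> G ->|F -> G ->|F ->].
Qed.

(** * Evaluation with bounded search *)

(** Shifting values by one leaves 0 for failure, so convergence reads [0 < oenc _] and the value 0
    reads [oenc _ = 1]. *)
Definition oenc (o : option nat) : nat := if o is Some y then y.+1 else 0.

(* Only the searches are bounded by [s]; a search that fails gives [None]. *)
Fixpoint eval (X : set nat) (Phi : functional) (s x : nat) : option nat :=
  match Phi with
  | Zero => Some 0
  | Succ => Some x.+1
  | Fst => Some (cfst x)
  | Snd => Some (csnd x)
  | Query => Some (nat_of_bool (x \in X))
  | Pair F G =>
      obind (fun u => omap (cpair u) (eval X G s x)) (eval X F s x)
  | Comp F G => obind (eval X F s) (eval X G s x)
  | Prec F G =>
      nat_rect (fun=> option nat) (eval X F s (cfst x))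
        (fun i => obind (fun z => eval X G s (cpair (cfst x) (cpair i z))))
        (csnd x)
  | Mu F =>
      (* The search stops at the first argument with value 0 or with no value; the test that follows
         tells the two apart. If nothing is found, [y] is [s], so the argument [s] is tested too. *)
      let y := find (fun z => oenc (eval X F s (cpair x z)) <= 1) (iota 0 s) in
      if oenc (eval X F s (cpair x y)) == 1 then Some y else None
  end.

Lemma eval_muP X F s x y : eval X (Mu F) s x = Some y <->
  [/\ y <= s, eval X F s (cpair x y) = Some 0 &
      forall z, z < y -> exists w, eval X F s (cpair x z) = Some w.+1].
Proof.
rewrite /=; set p := fun z => _.
have fs : find p (iota 0 s) <= s by rewrite -[X in _ <= X](size_iota 0) find_size.
split.
  case: eqP => // E [fy]; rewrite fy in E fs; split => //.
    by move: E; case: eval => //= u [->].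
  move=> z zy; have := @before_find _ 0 p (iota 0 s) z.
  rewrite fy => /(_ zy); rewrite nth_iota ?add0n ?(leq_trans zy) // /p.
  by case: eval => [[|w]|]//= _; exists w.
move=> [ys Ey lt]; suff -> : find p (iota 0 s) = y by rewrite Ey.
apply/eqP; rewrite eqn_leq; apply/andP; split.
  rewrite leqNgt; apply/negP => yf; have := before_find 0 yf.
  by rewrite nth_iota ?(leq_trans yf) // add0n /p Ey.
rewrite leqNgt; apply/negP => fy.
have hp : has p (iota 0 s).
  by rewrite has_find size_iota (leq_trans fy).
have := nth_find 0 hp; rewrite nth_iota ?add0n ?(leq_trans fy) // /p.
by have [w ->] := lt _ fy.
Qed.

(** For [Mu], a missing value is never skipped: a returned zero has all earlier values present and
    positive, so it remains the least zero at later stages. *)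
Lemma eval_mono X Phi s t x y :
  s <= t -> eval X Phi s x = Some y -> eval X Phi t x = Some y.
Proof.
move=> st; elim: Phi x y => // [F IF G IG|F IF G IG|F IF G IG|F IF] x y.
- rewrite /=; case EF: (eval X F s x) => [u|] //=.
  by case EG: (eval X G s x) => [v|] //= <-; rewrite (IF _ _ EF) /= (IG _ _ EG).
- rewrite /=; case EG: (eval X G s x) => [u|] //= EF.
  by rewrite (IG _ _ EG) /= (IF _ _ EF).
- rewrite /=; elim: (csnd x) y => [|n IHn] y /=; first exact: IF.
  case E: (nat_rect _ _ _ n) => [z|] //= EG.
  by rewrite (IHn _ E) /= (IG _ _ EG).
- move=> /eval_muP[ys Ey lt]; apply/eval_muP; split.
  + exact: leq_trans ys st.
  + exact: IF.
  + by move=> z /lt[w /IF]; exists w.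
Qed.

Lemma run_eval X Phi x y :
  run X Phi x y <-> exists s, eval X Phi s x = Some y.
Proof.
split; last first.
  move=> [s]; elim: Phi x y => [|||||F IF G IG|F IF G IG|F IF G IG|F IF] x y;
    try by case=> <-.
  - rewrite /=; case EF: (eval X F s x) => [u|] //=.
    case EG: (eval X G s x) => [v|] //= [<-].
    by exists u, v; split; [apply: IF | apply: IG |].
  - rewrite /=; case EG: (eval X G s x) => [u|] //= EF.
    by exists u; split; [apply: IG | apply: IF].
  - rewrite /=; elim: (csnd x) y => [|n IHn] y /=; first exact: IF.
    case E: (nat_rect _ _ _ n) => [z|] //= EG.
    by exists z; split; [apply: IHn | apply: IG].
  - move=> /eval_muP[_ Ey lt]; split; first exact: IF.
    by move=> z /lt[w /IF]; exists w.
elim: Phi x y => [|||||F IF G IG|F IF G IG|F IF G IG|F IF] x y;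
  try by move=> /= ->; exists 0.
- move=> /= [u [v [/IF[s Es] /IG[t Et] ->]]]; exists (maxn s t).
  by rewrite (eval_mono (leq_maxl _ _) Es) /= (eval_mono (leq_maxr _ _) Et).
- move=> /= [u [/IG[s Es] /IF[t Et]]]; exists (maxn s t).
  by rewrite (eval_mono (leq_maxl _ _) Es) /= (eval_mono (leq_maxr _ _) Et).
- rewrite /=; elim: (csnd x) y => [|n IHn] y /=; first exact: IF.
  move=> [z [/IHn[s Es] /IG[t Et]]]; exists (maxn s t).
  (* Monotonicity for the recursion itself, with counter [n], carries the intermediate value to the
     common stage. *)
  have := @eval_mono X (Prec F G) _ _ (cpair (cfst x) n) z (leq_maxl s t).
  by rewrite /= !cpairE => ->; rewrite //= (eval_mono (leq_maxr _ _) Et).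
- move=> [/IF[s Es] lt].
  (* The finitely many positive values below [y] are all present at one common stage. *)
  have [t Ht] : exists t, forall z, z < y ->
      exists w, eval X F t (cpair x z) = Some w.+1.
    elim: y lt {Es} => [|y IHy] lt; first by exists 0.
    have [|t Ht] := IHy; first by move=> z /ltnW; apply: lt.
    have [w /IF[u Eu]] := lt y (ltnSn y); exists (maxn t u) => z.
    rewrite ltnS leq_eqVlt => /predU1P[->|/Ht[v Ev]].
      by exists w; apply: eval_mono Eu; apply: leq_maxr.
    by exists v; apply: eval_mono Ev; apply: leq_maxl.
  exists (maxn y (maxn s t)); apply/eval_muP; split; first exact: leq_maxl.
    by apply: eval_mono Es; lia.
  by move=> z /Ht[w Ew]; exists w; apply: eval_mono Ew; lia.
Qed.

(** With every search bounded, evaluation is total, and factors such as [0 < a] propagate failure.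
    The parameter lets the simulated oracle vary with the input; [par], [s] and [x] are arbitrary
    because [Prec] and [Mu] evaluate at arguments depending on a bound variable. *)
Lemma rec_eval (O : set nat -> nat -> set nat) Phi par s x :
  recursive (fun X w => nat_of_bool (cfst w \in O X (csnd w))) ->
  recursive par -> recursive s -> recursive x ->
  recursive (fun X z => oenc (eval (O X (par X z)) Phi (s X z) (x X z))).
Proof.
move=> rO; elim: Phi par s x
  => [|||||F IF G IG|F IF G IG|F IF G IG|F IF] par s x rp rs rx /=;
  try by rec.
- apply: rec_succ; apply: eq_recursive (rec_comp rO (rec_pair rx rp)) => X z.
  by rewrite !cpairE.
- apply: (@eq_recursive (fun X z =>
    let a := oenc (eval (O X (par X z)) F (s X z) (x X z)) in
    let b := oenc (eval (O X (par X z)) G (s X z) (x X z)) in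
    (0 < a) * ((0 < b) * (cpair a.-1 b.-1).+1))).
    move=> X z /=; case: (eval _ F) => [a|] //=; case: (eval _ G) => [b|] //=.
    by rewrite !mul1n.
  by rewrite /=; rec; (apply: IF || apply: IG).
- apply: (@eq_recursive (fun X z =>
    let b := oenc (eval (O X (par X z)) G (s X z) (x X z)) in
    (0 < b) * oenc (eval (O X (par X z)) F (s X z) b.-1))).
    by move=> X z /=; case: (eval _ G) => [b|] //=; rewrite !mul1n.
  have rG := IG _ _ _ rp rs rx.
  by rewrite /=; rec; apply: IF => //; rec.
- apply: (@eq_recursive (fun X z => nat_rect (fun=> nat)
    (oenc (eval (O X (par X z)) F (s X z) (cfst (x X z))))
    (fun i r => (0 < r) * oenc (eval (O X (par X z)) G (s X z)
       (cpair (cfst (x X z)) (cpair i r.-1)))) (csnd (x X z)))).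
    move=> X z; elim: (csnd (x X z)) => //= n ->.
    by case: (nat_rect _ _ _ n) => [u|] //=; rewrite mul1n.
  apply: rec_nat_rect; last by rec.
    by apply: IF => //; rec.
  by rec; apply: IG; rec; apply: rec_on_fst => //; rec.
- apply: (@eq_recursive (fun X z =>
    let y := find (fun i => oenc (eval (O X (par X z)) F (s X z)
                                  (cpair (x X z) i)) <= 1) (iota 0 (s X z)) in
    (oenc (eval (O X (par X z)) F (s X z) (cpair (x X z) y)) == 1) * y.+1)).
    by move=> X z /=; case: ifP; rewrite ?mul1n.
  have ry : recursive (fun X z =>
      find (fun i => oenc (eval (O X (par X z)) F (s X z)
                                (cpair (x X z) i)) <= 1) (iota 0 (s X z))).
    by rec; apply: IF; rec; apply: rec_on_fst.
  by rewrite /=; rec; apply: IF => //; rec.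
Qed.

(** * Density *)

Lemma card_ord_count (p : pred nat) n :
  #|[pred k : 'I_n | p (val k)]| = count p (iota 0 n).
Proof.
by rewrite -sum1_card -sum1_count -[n in RHS]subn0 -/(index_iota 0 n) big_mkord.
Qed.

Lemma density1P D : density1 D <-> forall e : rat, (0 < e)%R ->
  exists N, forall n, N <= n ->
    ((count (predC (mem D)) (iota 0 n.+1))%:R < e * n.+1%:R)%R.
Proof.
(* The distance of the proportion from 1 is the proportion of the complement. *)
have dist n : (`|1 - #|[pred k : 'I_n.+1 | val k \in D]|%:R / n.+1%:R| =
    (count (predC (mem D)) (iota 0 n.+1))%:R / n.+1%:R :> rat)%R.
  rewrite (card_ord_count (mem D)).
  rewrite -[X in (X - _)%R](@divff _ n.+1%:R%R) ?pnatr_eq0 // -mulrBl.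
  rewrite -[X in (X%:R - _)%R](size_iota 0) -(count_predC (mem D)) natrD addrAC.
  by rewrite subrr add0r ger0_norm // divr_ge0.
split.
  move=> /cvgrPdist_lt h e /h[N _ HN]; exists N => n Nn.
  have := HN n.+1 (leq_trans Nn (leqnSn n)).
  by rewrite dist ltr_pdivrMr ?ltr0n.
move=> h; apply/cvgrPdist_lt => e /h[N HN]; exists N.+1 => // -[//|n] /= Nn.
by rewrite dist ltr_pdivrMr ?ltr0n // HN.
Qed.

Lemma cofinite_bound D :
  finite_set (~` D) <-> exists N, forall n, N <= n -> D n.
Proof.
split; last first.
  move=> [N HN]; apply: (@sub_finite_set _ _ `I_N) => // n nD /=.
  by rewrite ltnNge; apply/negP => /HN.
move=> /finite_seqP[F DF]; exists (\max_(i <- F) i).+1 => n.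
apply: contraPP => nD; apply/negP; rewrite -leqNgt.
have : [set` F] n by rewrite -DF.
by move=> nF; apply: (@leq_bigmax_seq _ _ _ id).
Qed.

Lemma cofinite_density1 D : finite_set (~` D) -> density1 D.
Proof.
move=> /cofinite_bound[N HN]; apply/density1P => e e0.
(* At most [N] points are missing, and [N < e * n.+1] once [n] reaches the integer part of
   [N / e]. *)
exists (Num.Def.truncn (N%:R / e))%R => n tn.
apply: (@le_lt_trans _ _ N%:R%R); last first.
  rewrite mulrC -ltr_pdivrMr //; apply: lt_le_trans (truncnS_gt _) _.
  by rewrite ler_nat.
rewrite ler_nat -size_filter -[leqRHS](size_iota 0).
apply: uniq_leq_size; first by rewrite filter_uniq // iota_uniq.
move=> k; rewrite mem_filter !mem_iota /= => /andP[/negP kD _].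
by rewrite ltnNge; apply/negP => /HN/mem_set.
Qed.

Lemma density1_block D : density1 D ->
  exists N, forall n, N <= n ->
    2 ^ n < 2 * count (fun m => 2 ^ n + m \in D) (iota 0 (2 ^ n)).
Proof.
(* With tolerance 1/4, fewer than a quarter of the [2 ^ n.+1] numbers below [2 ^ n.+1] are missing,
   hence fewer than half of the block of size [2 ^ n]. *)
move=> /density1P/(_ (4%:R^-1)%R)[|N HN]; first by rewrite invr_gt0 ltr0n.
exists N => n Nn.
have n2 : n < 2 ^ n by apply: ltn_expl.
have := HN (2 ^ n.+1).-1; rewrite prednK ?expn_gt0 //.
rewrite mulrC ltr_pdivlMr ?ltr0n // -natrM ltr_nat => /(_ _)/wrap[].
  by rewrite expnS; lia.
rewrite expnS mul2n -addnn iotaD count_cat add0n.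
have -> : iota (2 ^ n) (2 ^ n) = [seq 2 ^ n + m | m <- iota 0 (2 ^ n)].
  by rewrite -iotaDl addn0.
rewrite count_map.
have := count_predC (fun m => 2 ^ n + m \in D) (iota 0 (2 ^ n)).
rewrite size_iota.
set a := count _ _ => ab h.
set b := count (preim _ _) _ in h.
have : a + b = 2 ^ n by rewrite -ab.
lia.
Qed.

(** * Representing sets by dyadic blocks and by multiples *)

Lemma trunc_log2_block n m : m < 2 ^ n -> trunc_log 2 (2 ^ n + m) = n.
Proof. by move=> mn; apply: trunc_log_eq => //; rewrite expnS; lia. Qed.

Lemma logn2_odd n m : odd m -> logn 2 (2 ^ n * m) = n.
Proof.
move=> om; rewrite lognM ?expn_gt0 // ?odd_gt0 // pfactorK //.
by rewrite [logn 2 m]logn_coprime ?addn0 // coprime2n.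
Qed.

(** The conjunct [0 < k] excludes 0, which lies in no block although its logarithm is 0 by
    convention. *)
Lemma in_calRt S k : (k \in calRt S) = (0 < k) && (trunc_log 2 k \in S).
Proof.
apply/idP/idP => [/set_mem[n [m [Sn mn ->]]]|/andP[k0 /set_mem Sk]].
  by rewrite trunc_log2_block // addn_gt0 expn_gt0 /= mem_set.
have /andP[lo hi] := trunc_log_bounds (ltnSn 1) k0.
apply/mem_set; exists (trunc_log 2 k), (k - 2 ^ trunc_log 2 k).
by move: hi; rewrite expnS; split => //; lia.
Qed.

Lemma in_calR S k : (k \in calR S) = (0 < k) && (logn 2 k \in S).
Proof.
apply/idP/idP => [/set_mem[n [m [Sn om ->]]]|/andP[k0 /set_mem Sk]].
  by rewrite logn2_odd // muln_gt0 expn_gt0 /= odd_gt0 // mem_set.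
have [//|m om kE] := @pfactor_coprime 2 k _ k0.
by apply/mem_set; exists (logn 2 k), m; rewrite mulnC -kE -coprime2n.
Qed.

Lemma in_calRt_block S n m :
  m < 2 ^ n -> (2 ^ n + m \in calRt S) = (n \in S).
Proof.
by move=> mn; rewrite in_calRt trunc_log2_block // addn_gt0 expn_gt0.
Qed.

Lemma in_calR_odd S n m : odd m -> (2 ^ n * m \in calR S) = (n \in S).
Proof.
by move=> om; rewrite in_calR logn2_odd // muln_gt0 expn_gt0 /= odd_gt0.
Qed.

(** * Characteristic functions, partial oracles, finite tables and votes *)

Lemma eq_chi (F : pfun) S :
  (forall n y, F n y -> y = nat_of_bool (n \in S)) ->
  (forall n, exists y, F n y) -> F = chi S.
Proof.
move=> sound dom; apply/funext => n; apply/funext => y; apply/propext.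
split; first exact: sound.
by have [z Fz] := dom n; rewrite /chi => ->; rewrite -(sound _ _ Fz).
Qed.

Lemma total_chi S : Defs.total (chi S).
Proof. by apply/seteqP; split => // n _; exists (nat_of_bool (n \in S)). Qed.

Lemma agree_chi S T n : agree (chi S) (chi T) n <-> (n \in S) = (n \in T).
Proof.
split=> [[y [-> +]]|ST]; last by exists (nat_of_bool (n \in S)); rewrite /chi ST.
by rewrite /chi; case: (n \in S); case: (n \in T).
Qed.

Lemma agree_refl F : Defs.total F -> agree F F = setT.
Proof.
move=> Ft; apply/seteqP; split => // n _.
have [y Fy] : pdom F n by rewrite Ft.
by exists y.
Qed.

Lemma partial_oracleE A P n x l :
  partial_oracle A P -> P (n, x, l) -> x = (n \in A).
Proof.
move=> /(_ n l)[P0 P1]; case: x => [/P1 An|/P0 An]; first by rewrite mem_set.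
by apply/esym/negbTE; rewrite notin_setE.
Qed.

Lemma self_oracle_partial A : partial_oracle A (self_oracle A).
Proof.
move=> n l; split=> -[m [<- + _]]; last by move=> /esym/set_mem.
by move=> /esym/negbT; rewrite notin_setE.
Qed.

Lemma podom_self_oracle A : podom (self_oracle A) = setT.
Proof.
by apply/seteqP; split => // n _; exists (n \in A), 0, n.
Qed.

Lemma code_tripleP P c : (code_triple @` P) c <->
  exists x, cfst (csnd c) = nat_of_bool x /\ P (cfst c, x, csnd (csnd c)).
Proof.
split=> [[[[n x] l] Pt <-]|[x [xE Pt]]]; first by exists x; rewrite /= !cpairE.
by exists (cfst c, x, csnd (csnd c)); rewrite //= -xE !cpair_surj.
Qed.

Lemma rec_decide (O : set nat -> set nat) :
  recursive (fun X w => nat_of_bool (w \in O X)) ->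
  exists Psi, forall X, run X Psi = chi (O X).
Proof.
move=> [Psi H]; exists Psi => X.
by apply/funext => n; apply/funext => y; apply/propext; rewrite H.
Qed.

(** [B] is arbitrary: its first [N] bits are hardwired into the program rather than computed from
    the oracle. *)
Lemma rec_table N (B : set nat) :
  recursive (fun X n => nat_of_bool ((n < N) && (n \in B))).
Proof.
elim: N => [|N IH]; first exact: rec_const.
apply: (@eq_recursive (fun X n =>
  ((n < N) && (n \in B)) || ((n == N) && (N \in B)))); last by rec.
move=> X n; rewrite [in RHS]ltnS [in RHS]leq_eqVlt.
by case: eqP => [->|_]; rewrite ?ltnn ?orbF.
Qed.

(** The [p]-voters form a strict majority and all vote [b]; when [b] is false, they show that the
    votes against are more than half. *)
Lemma majority (p q : pred nat) N b :
  (forall m, m < N -> p m -> q m = b) ->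
  N < 2 * count p (iota 0 N) -> (N < 2 * count q (iota 0 N)) = b.
Proof.
move=> pq; have := count_predC q (iota 0 N); rewrite size_iota.
have le (r : pred nat) : (forall m, m < N -> p m -> r m) ->
    count p (iota 0 N) <= count r (iota 0 N).
  move=> pr; rewrite -!size_filter; apply: uniq_leq_size.
    by rewrite filter_uniq ?iota_uniq.
  move=> m; rewrite !mem_filter mem_iota /= => /andP[pm mN].
  by rewrite mN pr.
case: b pq => pq.
  have := le q pq; lia.
have := le (predC q) _; move=> /(_ _)/wrap[m mN pm /=|]; first by rewrite pq.
lia.
Qed.

Lemma uniform_bound (R : nat -> nat -> Prop) n :
  (forall s t m, s <= t -> R m s -> R m t) ->
  (forall m, m < n -> exists s, R m s) ->
  exists s, forall m, m < n -> R m s.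
Proof.
move=> mono; elim: n => [|n IH] ex; first by exists 0.
have [m /ltnW|s Hs] := IH; first exact: ex.
have [t Ht] := ex n (ltnSn n); exists (maxn s t) => m.
rewrite ltnS leq_eqVlt => /predU1P[->|/Hs].
  exact: mono (leq_maxr _ _) Ht.
exact: mono (leq_maxl _ _).
Qed.

(** * The map [calR] *)

Lemma calR_lift Phi :
  exists Psi, forall X B, run X Phi = chi B -> run X Psi = chi (calR B).
Proof.
have rh : recursive (fun X c => (0 < cfst c) * csnd c) by rec.
have [Psi H] := run_map Phi (rec_logn2 rec_id) rh.
exists Psi => X B PhiB; apply/funext => k; apply/funext => y; apply/propext.
rewrite H PhiB /chi in_calR -mulnb; split => [[u -> ->]|->].
  by rewrite !cpairE.
by exists (nat_of_bool (logn 2 k \in B)); rewrite ?cpairE.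
Qed.

Lemma calR_unlift Phi :
  exists Psi, forall X B, run X Phi = chi (calR B) -> run X Psi = chi B.
Proof.
have rg : recursive (fun X n => 2 ^ n) by rec.
have rh : recursive (fun X c => csnd c) by rec.
have [Psi H] := run_map Phi rg rh.
exists Psi => X B PhiB; apply/funext => n; apply/funext => y; apply/propext.
have nB : (2 ^ n \in calR B) = (n \in B) by rewrite -[2 ^ n]muln1 in_calR_odd.
rewrite H PhiB /chi nB; split => [[u -> ->]|->]; first by rewrite cpairE.
by exists (nat_of_bool (n \in B)); rewrite ?cpairE.
Qed.

Lemma rec_calR : recursive (fun X k => nat_of_bool (k \in calR X)).
Proof.
apply: (@eq_recursive (fun X k => (0 < k) && (logn 2 k \in X))).
  by move=> X k; rewrite in_calR.
by rec; apply: rec_logn2; rec.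
Qed.

Lemma rec_calRt : recursive (fun X k => nat_of_bool (k \in calRt X)).
Proof.
apply: (@eq_recursive (fun X k => (0 < k) && (trunc_log 2 k \in X))).
  by move=> X k; rewrite in_calRt.
by rec; apply: rec_log2; rec.
Qed.

Lemma le_T_cf_calR A B : le_T B A -> le_cf (calR B) (calR A).
Proof.
move=> [Phi PhiB].
have [Q HQ] : exists Q, forall P, partial_oracle (calR A) P ->
    finite_set (~` podom P) -> run_partial P Q = chi A.
  (* A candidate [s] codes an odd multiplier together with the value and step count of a triple; the
     value is the answer. *)
  have [||Q HQ] := @recursive_search
    (fun X i s => odd (cfst s) && (cpair (2 ^ i * cfst s) (csnd s) \in X))
    (fun X i s => cfst (csnd s)).
  - apply: (@eq_recursive (fun X w => ~~ (2 %| cfst (csnd w)) &&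
      (cpair (2 ^ cfst w * cfst (csnd w)) (csnd (csnd w)) \in X))).
      by move=> X w; rewrite dvdn2 negbK.
    by rec; apply: rec_dvdn; rec.
  - by rec.
  exists Q => P PA /cofinite_bound[N HN].
  apply: eq_chi => i; have [sound dom] := HQ (code_triple @` P) i.
    move=> y /sound[s /andP[os /set_mem/code_tripleP[x [xE Pt]]] ->].
    rewrite !cpairE in xE Pt; rewrite xE (partial_oracleE PA Pt).
    by rewrite in_calR_odd.
  (* [N.*2.+1] is odd and exceeds [N], so this multiple lies in the class of [i] and in the domain
     of the oracle. *)
  have [|x [l Pt]] := HN (2 ^ i * N.*2.+1).
    have : 0 < 2 ^ i by rewrite expn_gt0.
    nia.
  apply: dom; exists (cpair N.*2.+1 (cpair x l)).
  rewrite !cpairE /= odd_double; apply/mem_set/code_tripleP.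
  by exists x; rewrite !cpairE.
have [Psi HPsi] := calR_lift (subst_query Q Phi).
have main P : partial_oracle (calR A) P -> finite_set (~` podom P) ->
    run_partial P Psi = chi (calR B).
  by move=> PA Pcof; apply: HPsi; rewrite (run_subst_query _ (HQ P PA Pcof)).
exists Psi; split.
  apply: main; first exact: self_oracle_partial.
  by rewrite podom_self_oracle setCT; apply: finite_set0.
move=> P PA Pcof; rewrite main //; split; first by move=> n y z -> ->.
by rewrite total_chi setCT; apply: finite_set0.
Qed.

(** The self oracle of [calR A] is decidable from [A]: a triple must carry the correct bit and step
    count 0. On this oracle the reduction is exact. *)
Lemma cf_calR_le_T A B : le_cf (calR B) (calR A) -> le_T B A.
Proof.
move=> [Phi [PhiB _]].
have [Q HQ] : exists Q, forall X,
    run X Q = chi (code_triple @` self_oracle (calR X)).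
  apply: rec_decide; apply: (@eq_recursive (fun X c =>
    (cfst (csnd c) == (cfst c \in calR X)) && (csnd (csnd c) == 0))).
    move=> X c; congr nat_of_bool; apply/andP/idP => [[/eqP cE /eqP c0]|].
      apply/mem_set/code_tripleP; exists (cfst c \in calR X).
      by split=> //; exists (cfst c); rewrite c0.
    by move=> /set_mem/code_tripleP[x [-> [n [-> -> ->]]]].
  by rec; apply: rec_comp rec_calR _; rec.
have [Psi HPsi] := calR_unlift (subst_query Q Phi).
by exists Psi; apply: HPsi; rewrite (run_subst_query _ (HQ A)).
Qed.

(* On input [k] the oracle of [A] is approximated from [C] by asking, at stage
   [s >= k], about [2 ^ i * s.*2.+1]: almost every stage gives [A] itself, so
   the search succeeds, and for almost every [k] all stages give [A]. *)
Lemma le_T_mf_calR A B : le_T B A -> le_mf (calR B) (calR A).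
Proof.
move=> [Phi PhiB].
pose O (X : set nat) s : set nat := [set i | 2 ^ i * s.*2.+1 \in X].
have rO : recursive (fun X w => nat_of_bool (cfst w \in O X (csnd w))).
  apply: (@eq_recursive (fun X w =>
    2 ^ cfst w * (csnd w + csnd w).+1 \in X)); last by rec.
  by move=> X w; rewrite addnn; congr nat_of_bool; apply/idP/idP;
    [move=> h; apply: mem_set | move=> /set_mem].
pose e X k t := oenc (eval (O X (k + t)) Phi (k + t) (logn 2 k)).
have re : recursive (fun X w => e X (cfst w) (csnd w)).
  by apply: rec_eval => //; rec; apply: rec_logn2; rec.
have [||Psi HPsi] := @recursive_search (fun X k t => 0 < e X k t)
  (fun X k t => (0 < k) * (e X k t).-1); try by rec.
have main C N : (forall k, N <= k -> (k \in C) = (k \in calR A)) ->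
    Defs.total (run C Psi) /\
    forall k y, N <= k -> run C Psi k y -> y = nat_of_bool (k \in calR B).
  move=> CA; have OA s : N <= s -> O C s = A.
    move=> Ns; apply/seteqP; have Cs i : (2 ^ i * s.*2.+1 \in C) = (i \in A).
      rewrite CA ?in_calR_odd //= ?odd_double //.
      have : 0 < 2 ^ i by rewrite expn_gt0.
      nia.
    by split=> i; rewrite /O /= Cs => h; [apply/set_mem | apply/mem_set].
  split.
    apply/seteqP; split => // k _; apply: (HPsi C k).2.
    have : run A Phi (logn 2 k) (nat_of_bool (logn 2 k \in B)) by rewrite PhiB.
    (* A stage beyond [N] has the true oracle [A], and one beyond [s] has enough search bound. *)
    move=> /run_eval[s Es]; exists (maxn N s).
    by rewrite /e OA ?(eval_mono _ Es) //; lia.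
  move=> k y Nk /(HPsi C k).1[t + ->]; rewrite /e OA; last by lia.
  case E: eval => [u|] // _; have : run A Phi (logn 2 k) u.
    by apply/run_eval; exists (k + t).
  by rewrite PhiB in_calR -mulnb => ->.
exists Psi; split.
  (* With the exact oracle the error threshold is 0, so every answer is correct. *)
  have [tot sound] := @main (calR A) 0 (fun _ _ => erefl).
  apply: eq_chi => k; first by move=> y; apply: sound.
  by have : pdom (run (calR A) Psi) k by rewrite tot.
move=> C /cofinite_bound[N HN].
have [|tot sound] := @main C N; first by move=> k /HN/agree_chi.
split=> //; apply/cofinite_bound; exists N => k Nk.
have [y Cy] : pdom (run C Psi) k by rewrite tot.
by exists y; split => //; apply: sound Cy.
Qed.

Lemma mf_calR_le_T A B : le_mf (calR B) (calR A) -> le_T B A.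
Proof.
move=> [Phi [PhiB _]]; have [Q HQ] := rec_decide rec_calR.
have [Psi HPsi] := calR_unlift (subst_query Q Phi).
by exists Psi; apply: HPsi; rewrite (run_subst_query _ (HQ A)).
Qed.

(** * The map [calRt] *)

(** Each block is finite, so finitely many exceptional logarithms produce finitely many exceptional
    numbers. *)
Lemma cofinite_log2 (D E : set nat) : finite_set (~` D) ->
  (forall k, 0 < k -> D (trunc_log 2 k) -> E k) -> finite_set (~` E).
Proof.
move=> /cofinite_bound[N HN] DE; apply/cofinite_bound; exists (2 ^ N) => k Nk.
apply: DE; first by apply: leq_trans Nk; rewrite expn_gt0.
by apply/HN/trunc_log_max.
Qed.

Lemma calRt_lift Phi : exists Psi, forall X k y,
  run X Psi k y <->
  exists2 u, run X Phi (trunc_log 2 k) u & y = (0 < k) * u.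
Proof.
have rh : recursive (fun X c => (0 < cfst c) * csnd c) by rec.
have [Psi H] := run_map Phi (rec_log2 rec_id) rh.
exists Psi => X k y.
by rewrite H; split=> -[u Pu ->]; exists u; rewrite // !cpairE.
Qed.

(** A partial oracle for [A] is assembled from one for [calRt A]: any answer inside block [i] gives
    bit [i]. Several offsets [m] may answer, so [m] is stored in the step count as [cpair m l].
    Density 1 makes almost every block contain an answer. *)
Lemma le_cf_g_calRt A B : le_cf B A -> le_g (calRt B) (calRt A).
Proof.
move=> [Phi [_ HPhi]].
pose O (X : set nat) : set nat := [set c | cfst (csnd (csnd c)) < 2 ^ cfst c /\
  X (cpair (2 ^ cfst c + cfst (csnd (csnd c)))
    (cpair (cfst (csnd c)) (csnd (csnd (csnd c)))))].
have [Q HQ] : exists Q, forall X, run X Q = chi (O X).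
  apply: rec_decide; apply: (@eq_recursive (fun X c =>
    (cfst (csnd (csnd c)) < 2 ^ cfst c) &&
    (cpair (2 ^ cfst c + cfst (csnd (csnd c)))
      (cpair (cfst (csnd c)) (csnd (csnd (csnd c)))) \in X))); last by rec.
  move=> X c; congr nat_of_bool; apply/andP/idP.
    by move=> [lt /set_mem Xc]; apply/mem_set.
  by move=> /set_mem[lt /mem_set].
have [Psi HPsi] := calRt_lift (subst_query Q Phi).
exists Psi => P PA Pdens.
pose P' : triples := [set t | let: (i, x, l) := t in
  cfst l < 2 ^ i /\ P (2 ^ i + cfst l, x, csnd l)].
have OP : O (code_triple @` P) = code_triple @` P'.
  apply/seteqP; split=> c.
    move=> [lt /code_tripleP[x]]; rewrite !cpairE => -[xE Px].
    by apply/code_tripleP; exists x.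
  move=> /code_tripleP[x [xE [lt Px]]]; split=> //.
  by apply/code_tripleP; exists x; rewrite !cpairE.
have P'A : partial_oracle A P'.
  by move=> i l; split=> -[lt /(partial_oracleE PA)]; rewrite in_calRt_block //;
    [move=> /esym/negbT; rewrite notin_setE | move=> /esym/set_mem].
have P'cof : finite_set (~` podom P').
  have [N HN] := density1_block Pdens; apply/cofinite_bound; exists N => i /HN.
  move=> /(leq_ltn_trans (leq0n _)); rewrite muln_gt0 /= -has_count.
  move=> /hasP[m]; rewrite mem_iota /= => mi /set_mem[x [l Pl]].
  by exists x, (cpair m l); rewrite /P' /= !cpairE.
have [comp cof] := HPhi P' P'A P'cof.
have runE : run (code_triple @` P) (subst_query Q Phi) = run_partial P' Phi.
  by rewrite (run_subst_query _ (HQ _)) OP.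
split.
  apply: cofinite_density1; apply: cofinite_log2 cof _ => k k0 [u Pu].
  by exists u; apply/HPsi; rewrite runE; exists u; rewrite // k0 mul1n.
move=> k y z /HPsi[u]; rewrite runE => Pu -> ->.
by rewrite in_calRt (comp _ _ _ Pu erefl) mulnb.
Qed.

(** A cofinite oracle for [A] lifts to a density-1 oracle for [calRt A]. One convergent computation
    in block [n] determines bit [n] of [B], and almost every block has one. *)
Lemma le_g_cf_calRt A B : le_g (calRt B) (calRt A) -> le_cf B A.
Proof.
move=> [Phi HPhi].
pose O (X : set nat) (_ : nat) : set nat :=
  [set c | 0 < cfst c /\ X (cpair (trunc_log 2 (cfst c)) (csnd c))].
have rO : recursive (fun X w => nat_of_bool (cfst w \in O X (csnd w))).
  apply: (@eq_recursive (fun X w => (0 < cfst (cfst w)) &&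
    (cpair (trunc_log 2 (cfst (cfst w))) (csnd (cfst w)) \in X))).
    move=> X w; congr nat_of_bool; apply/andP/idP.
      by move=> [lt /set_mem Xc]; apply/mem_set.
    by move=> /set_mem[lt /mem_set].
  by rec; apply: rec_log2; rec.
pose lift (P : triples) : triples := [set t | let: (k, x, l) := t in
  0 < k /\ P (trunc_log 2 k, x, l)].
have Olift P : O (code_triple @` P) 0 = code_triple @` (lift P).
  apply/seteqP; split=> c.
    move=> [lt /code_tripleP[x]]; rewrite !cpairE => -[xE Px].
    by apply/code_tripleP; exists x.
  move=> /code_tripleP[x [xE [lt Px]]]; split=> //.
  by apply/code_tripleP; exists x; rewrite !cpairE.
have runlift P : partial_oracle A P -> finite_set (~` podom P) ->
    density1 (pdom (run_partial (lift P) Phi)) /\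
    compat (run_partial (lift P) Phi) (chi (calRt B)).
  move=> PA Pcof; apply: HPhi.
    by move=> k l; split=> -[k0 /(partial_oracleE PA) xE];
      [rewrite -notin_setE | apply/set_mem];
      rewrite in_calRt k0 -xE.
  apply: cofinite_density1; apply: cofinite_log2 Pcof _ => k k0 [x [l Pl]].
  by exists x, l.
(* [s] codes a stage and an offset in the block, which dovetails the computations over the block. *)
pose e X n s := oenc (eval (O X 0) Phi (cfst s) (2 ^ n + csnd s)).
have re : recursive (fun X w => e X (cfst w) (csnd w)).
  by apply: (@rec_eval O Phi (fun _ _ => 0)) => //; rec.
have found P : partial_oracle A P -> finite_set (~` podom P) ->
    exists N, forall n, N <= n -> exists s,
      (csnd s < 2 ^ n) && (0 < e (code_triple @` P) n s).
  move=> PA /(runlift P PA)[/density1_block[N HN] _]; exists N => n /HN.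
  move=> /(leq_ltn_trans (leq0n _)); rewrite muln_gt0 /= -has_count.
  move=> /hasP[m]; rewrite mem_iota /= => mn /set_mem[u].
  rewrite /run_partial -Olift => /run_eval[t Et]; exists (cpair t m).
  by rewrite /e !cpairE Et andbT.
have sound P n s : partial_oracle A P -> finite_set (~` podom P) ->
    csnd s < 2 ^ n -> 0 < e (code_triple @` P) n s ->
    (e (code_triple @` P) n s).-1 = (n \in B).
  move=> PA Pcof sn; rewrite /e; case E: eval => [u|] //= _.
  have [_ comp] := runlift P PA Pcof.
  have Pu : run_partial (lift P) Phi (2 ^ n + csnd s) u.
    by rewrite /run_partial -Olift; apply/run_eval; exists (cfst s).
  by rewrite (comp _ _ _ Pu erefl) in_calRt_block.
have selfcof : finite_set (~` podom (self_oracle A)).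
  by rewrite podom_self_oracle setCT; apply: finite_set0.
have [N HN] := found _ (@self_oracle_partial A) selfcof.
(* The search may fail for [n < N] even with the full oracle; there [B] is
   read off a finite table, which makes the reduction total on [A] itself. *)
have [||Psi HPsi] := @recursive_search
  (fun X n s => (n < N) || (csnd s < 2 ^ n) && (0 < e X n s))
  (* The repeated guard keeps the branch recursive by itself, being a finite table, whereas
     [n \in B] need not be. *)
  (fun X n s => if n < N then nat_of_bool ((n < N) && (n \in B)) else (e X n s).-1).
- by rec.
- apply: rec_if; [by rec | | by rec].
  exact: rec_on_fst (rec_table N B).
have Psi_sound P n y : partial_oracle A P -> finite_set (~` podom P) ->
    run_partial P Psi n y -> y = (n \in B).
  move=> PA Pcof /(HPsi _ n).1[s + ->]; case: ltnP => //= _ /andP[sn es].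
  exact: sound.
exists Psi; split.
  apply: eq_chi => n.
    by move=> y; apply: Psi_sound; first exact: self_oracle_partial.
  apply: (HPsi _ n).2; case: (ltnP n N) => [nN|/HN[s es]]; last by exists s.
  by exists 0.
move=> P PA Pcof; split; first by move=> n y z /Psi_sound-> // ->.
have [M HM] := found P PA Pcof; apply/cofinite_bound; exists M => n /HM[s es].
by apply: (HPsi _ n).2; exists s; rewrite es orbT.
Qed.

(** The set of majority votes over blocks differs from [A] at finitely many places, so it is a
    legitimate input for the mod-finite reduction. *)
Lemma le_mf_cor_calRt A B : le_mf B A -> le_cor (calRt B) (calRt A).
Proof.
move=> [Phi [_ HPhi]].
pose O (X : set nat) : set nat := [set i |
  2 ^ i < 2 * count (fun m => 2 ^ i + m \in X) (iota 0 (2 ^ i))].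
have [Q HQ] : exists Q, forall X, run X Q = chi (O X).
  apply: rec_decide; apply: (@eq_recursive (fun X i =>
    2 ^ i < 2 * count (fun m => 2 ^ i + m \in X) (iota 0 (2 ^ i)))).
    by move=> X i; congr nat_of_bool; apply/idP/idP;
      [move=> h; apply: mem_set | move=> /set_mem].
  by rec.
have [Psi HPsi] := calRt_lift (subst_query Q Phi).
exists Psi => C Cdens.
have [N HN] := density1_block Cdens.
have OA : finite_set (~` agree (chi (O C)) (chi A)).
  apply/cofinite_bound; exists N => i /HN iN; apply/agree_chi.
  (* The offsets where [C] agrees with [calRt A] are the majority, and each votes for the bit [i] of
     [A]. *)
  rewrite -(@majority _ (fun m => 2 ^ i + m \in C) _ (i \in A) _ iN).
    by apply/idP/idP; [move=> /set_mem | move=> h; apply: mem_set].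
  by move=> m mi /set_mem/agree_chi ->; rewrite in_calRt_block.
have [tot cof] := HPhi _ OA.
have runE : run C (subst_query Q Phi) = run (O C) Phi.
  by rewrite (run_subst_query _ (HQ _)).
split.
  apply/seteqP; split=> // k _.
  have [u Pu] : pdom (run (O C) Phi) (trunc_log 2 k) by rewrite tot.
  by exists ((0 < k) * u); apply/HPsi; rewrite runE; exists u.
apply: cofinite_density1; apply: cofinite_log2 cof _ => k k0 [u [Pu uB]].
exists u; split; first by apply/HPsi; rewrite runE k0; exists u; rewrite ?mul1n.
by rewrite /chi in_calRt k0 uB.
Qed.

(** Totality of the coarse reduction allows waiting until every computation in block [n] has halted;
    a vote over the block then gives bit [n] of [B] for almost every [n]. *)
Lemma le_cor_mf_calRt A B : le_cor (calRt B) (calRt A) -> le_mf B A.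
Proof.
move=> [Phi HPhi].
pose e X n s m := oenc (eval (calRt X) Phi s (2 ^ n + m)).
have re : recursive (fun X w =>
    e X (cfst (cfst w)) (csnd (cfst w)) (csnd w)).
  apply: (@rec_eval (fun X _ => calRt X) Phi (fun _ _ => 0)); rec.
  by apply: rec_comp rec_calRt _; rec.
(* The code 2 stands for [Some 1], a vote for membership. *)
pose major X n s := 2 ^ n < 2 * count (fun m => e X n s m == 2) (iota 0 (2 ^ n)).
have block C : finite_set (~` agree (chi C) (chi A)) ->
    Defs.total (run (calRt C) Phi) /\
    density1 (agree (run (calRt C) Phi) (chi (calRt B))).
  move=> Ccof; apply: HPhi; apply: cofinite_density1.
  apply: cofinite_log2 Ccof _ => k k0 /agree_chi kE.
  by apply/agree_chi; rewrite !in_calRt k0 kE.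
have sound C : finite_set (~` agree (chi C) (chi A)) ->
    exists N, forall n s, N <= n -> all (fun m => 0 < e C n s m) (iota 0 (2 ^ n)) ->
      major C n s = (n \in B).
  move=> /block[_ /density1_block[N HN]]; exists N => n s /HN maj /allP es.
  apply: majority maj => m mn /set_mem[u [Pu uB]].
  have := es m; rewrite mem_iota => /(_ mn); rewrite /e.
  case E: eval => [v|] //= _.
  have -> : v = (n \in B).
    rewrite -(in_calRt_block _ mn) -uB; apply: (@run_functional (calRt C) Phi).
      by apply/run_eval; exists s; apply: E.
    exact: Pu.
  by case: (n \in B).
have Acof : finite_set (~` agree (chi A) (chi A)).
  by rewrite agree_refl ?setCT; [apply: finite_set0 | apply: total_chi].
(* For [A] itself the vote is correct from [N] on, and a table below [N] makes the reduction exact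
   on [A]. *)
have [N HN] := sound A Acof.
have [||Psi HPsi] := @recursive_search
  (fun X n s => all (fun m => 0 < e X n s m) (iota 0 (2 ^ n)))
  (fun X n s => if n < N then nat_of_bool ((n < N) && (n \in B)) else nat_of_bool (major X n s)).
- by rec.
- apply: rec_if; [by rec | | by rewrite /major; rec].
  exact: rec_on_fst (rec_table N B).
have Psi_total C : finite_set (~` agree (chi C) (chi A)) -> Defs.total (run C Psi).
  move=> /block[tot _]; apply/seteqP; split=> // n _; apply: (HPsi C n).2.
  have [||s Hs] := @uniform_bound (fun m s => 0 < e C n s m) (2 ^ n).
  - move=> s t m st; rewrite /e; case E: eval => [u|] // _.
    by rewrite (eval_mono st E).
  - move=> m _; have [u] : pdom (run (calRt C) Phi) (2 ^ n + m) by rewrite tot.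
    by move=> /run_eval[s E]; exists s; rewrite /e E.
  by exists s; apply/allP => m; rewrite mem_iota => /Hs.
exists Psi; split.
  apply: eq_chi => n; last first.
    by have : pdom (run A Psi) n by rewrite Psi_total.
  move=> y /(HPsi A n).1[s es ->]; case: ltnP => //= Nn.
  by rewrite (HN _ _ Nn es).
move=> C Ccof; split; first exact: Psi_total.
(* Beyond [N] the answer is the vote rather than the table, and beyond [M] the vote from [C] is
   correct. *)
have [M HM] := sound C Ccof; apply/cofinite_bound; exists (maxn M N) => n.
rewrite geq_max => /andP[Mn Nn].
have [y Cy] : pdom (run C Psi) n by rewrite Psi_total.
exists y; split=> //; have [s es ->] := (HPsi C n).1 _ Cy.
by rewrite ltnNge Nn /= (HM _ _ Mn es).
Qed.

Theorem proposition3p3 :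
  (forall A B : set nat, le_cf B A <-> le_g (calRt B) (calRt A)) /\
  (forall A B : set nat, le_mf B A <-> le_cor (calRt B) (calRt A)) /\
  (forall A B : set nat, le_T B A <-> le_cf (calR B) (calR A)) /\
  (forall A B : set nat, le_T B A <-> le_mf (calR B) (calR A)).
Proof.
split; first by split; [apply: le_cf_g_calRt | apply: le_g_cf_calRt].
split; first by split; [apply: le_mf_cor_calRt | apply: le_cor_mf_calRt].
split; first by split; [apply: le_T_cf_calR | apply: cf_calR_le_T].
by split; [apply: le_T_mf_calR | apply: mf_calR_le_T].
Qed.
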